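(* Let $\mathcal H$ be a (possibly infinite-dimensional) separable complex Hilbert space, let $s\in\mathbb N$, and let $\mathcal F\subset\mathrm L(\mathcal H)$ be the set of all self-adjoint operators of finite rank which have at most $s$ positive and at most $s$ negative eigenvalues. Then $\mathcal F$ is a Polish space. More precisely, endowed with the metric $d$ induced by the operator norm on $\mathrm L(\mathcal H)$, the space $(\mathcal F,d)$ is a separable, complete metric space.
   Context: $\mathrm L(\mathcal H)$ is the space of bounded linear operators on $\mathcal H$ with the operator norm. Eigenvalues are counted with multiplicities. (In the terminology of causal fermion systems, $(\mathcal H,\mathcal F,\rho)$ with a measure $\rho$ on the Borel $\sigma$-algebra of $\mathcal F$ is a causal fermion system of spin dimension $s$.) *)

(* Defs.v *)
From HB Require Import structures.
From mathcomp Require Import all_boot all_order all_algebra.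
From mathcomp Require Import complex.
From mathcomp Require Import all_classical all_reals all_analysis.

Set Implicit Arguments.
Unset Strict Implicit.
Unset Printing Implicit Defensive.

Import Order.TTheory GRing.Theory Num.Theory.
Import numFieldNormedType.Exports.

Local Open Scope classical_set_scope.
Local Open Scope ring_scope.
Local Open Scope complex_scope.

(* [{dot H for conj}] is linear in its first argument and conjugate-linear in
   its second one. *)
HB.mixin Record isHilbert (R : realType) H & CompleteNormedModule R[i] H := {
  hdot : {dot H for (@Num.conj R[i])} ;
  hdot_norm : forall x : H, hdot x x = `|x| ^+ 2
}.

#[short(type="hilbertType")]
HB.structure Definition Hilbert (R : realType) :=
  {H of CompleteNormedModule R[i] H & isHilbert R H}.

Section OperatorNorm.
Context {R : realType} {V : normedModType R[i]}.
Implicit Types (x : V) (A : V -> V).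

(* The library norm of a complex normed module takes its values in [R[i]]. *)
Definition rnorm x : R := complex.Re `|x|.

Lemma rnormE x : `|x| = (rnorm x)%:C.
Proof. by rewrite /rnorm RRe_real ?normr_real. Qed.

Lemma rnorm_ge0 x : 0 <= rnorm x.
Proof. by rewrite -ler0c -rnormE. Qed.

Lemma rnorm0 : rnorm (0 : V) = 0.
Proof. by rewrite /rnorm normr0. Qed.

Lemma rnorm_eq0 x : rnorm x = 0 -> x = 0.
Proof. by move=> x0; apply/normr0_eq0; rewrite rnormE x0. Qed.

Lemma rnormD x y : rnorm (x + y) <= rnorm x + rnorm y.
Proof. by rewrite -lecR rmorphD /= -!rnormE ler_normD. Qed.

Lemma rnormZ (l : R[i]) x : rnorm (l *: x) = complex.Re `|l| * rnorm x.
Proof.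
apply: (@complexI R).
by rewrite -(rnormE (l *: x)) normrZ rmorphM/= -(rnormE x).
Qed.

Definition bounded_op : {pred V -> V} :=
  [pred A : V -> V | `[< linear A /\ exists C : R,
     forall x, rnorm (A x) <= C * rnorm x >]].

Definition opnorm A : R := sup [set rnorm (A x) | x in [set x | rnorm x <= 1]].

Lemma bounded_opP A : reflect (linear A /\ exists C : R,
  forall x, rnorm (A x) <= C * rnorm x) (A \in bounded_op).
Proof. exact: asboolP. Qed.

Lemma opnorm_ubound A x : A \in bounded_op -> rnorm x <= 1 ->
  rnorm (A x) <= opnorm A.
Proof.
move=> /bounded_opP[_ [C hC]] x1; apply: sup_upper_bound; last by exists x.
split; first by exists (rnorm (A x)), x.
exists `|C| => _ [y y1 <-]; apply: (le_trans (hC y)).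
apply: (le_trans (ler_wpM2r (rnorm_ge0 y) (ler_norm C))).
by rewrite ler_piMr.
Qed.

Lemma linear_at0 A : linear A -> A 0 = 0.
Proof. by move=> /(_ (-1) 0 0); rewrite scaler0 addr0 scaleN1r addNr. Qed.

Lemma linear_atZ A l x : linear A -> A (l *: x) = l *: A x.
Proof. by move=> lA; rewrite -[l *: x]addr0 lA linear_at0 ?addr0. Qed.

Lemma opnorm_ge0 A : A \in bounded_op -> 0 <= opnorm A.
Proof.
move=> bA; have /bounded_opP[lA _] := bA.
by have := @opnorm_ubound A 0 bA; rewrite linear_at0// rnorm0; apply.
Qed.

Lemma opnormP A x : A \in bounded_op -> rnorm (A x) <= opnorm A * rnorm x.
Proof.
move=> bA; have /bounded_opP[lA _] := bA.
have [/rnorm_eq0 ->|x0] := eqVneq (rnorm x) 0.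
  by rewrite linear_at0// rnorm0 mulr0.
have xp : 0 < rnorm x by rewrite lt_neqAle eq_sym x0 rnorm_ge0.
have nV : complex.Re `|((rnorm x)^-1)%:C| = (rnorm x)^-1.
  by rewrite ger0_norm// ler0c invr_ge0 ltW.
have := @opnorm_ubound A (((rnorm x)^-1)%:C *: x) bA.
rewrite linear_atZ// !rnormZ nV mulVf// lexx => /(_ isT).
by rewrite mulrC ler_pdivrMr.
Qed.

Lemma opnorm_le A (C : R) : 0 <= C ->
  (forall x, rnorm (A x) <= C * rnorm x) -> opnorm A <= C.
Proof.
move=> C0 AC; apply: ge_sup.
  by exists (rnorm (A 0)), 0 => //=; rewrite rnorm0.
move=> _ [x /= x1 <-]; apply: (le_trans (AC x)).
by rewrite ler_piMr.
Qed.

Lemma bounded_op_submod : submod_closed bounded_op.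
Proof.
split.
- apply/bounded_opP; split.
    by move=> l x y; rewrite [RHS]addr0 scaler0.
  by exists 0 => x; rewrite [X in X <= _]rnorm0 mul0r.
- move=> l A B /bounded_opP[lA [C hC]] /bounded_opP[lB [D hD]].
  have E x : (l *: A + B) x = l *: A x + B x by [].
  apply/bounded_opP; split.
    move=> k x y; rewrite !E lA lB !scalerDr !scalerA [l * k]mulrC.
    by rewrite addrACA.
  exists (complex.Re `|l| * C + D) => x; rewrite E.
  rewrite (le_trans (rnormD _ _))// rnormZ mulrDl lerD// -mulrA.
  by rewrite ler_wpM2l// -ler0c RRe_real ?normr_real.
Qed.

HB.instance Definition _ :=
  GRing.isSubmodClosed.Build R[i] (V -> V) bounded_op bounded_op_submod.

End OperatorNorm.

(* [bop V] is the space L(V) of bounded linear operators on [V]. *)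
Record bop {R : realType} (V : normedModType R[i]) :=
  BOp { bop_fun :> V -> V ; bop_funP : bop_fun \in bounded_op }.

Section BoundedOperators.
Context {R : realType} {V : normedModType R[i]}.
Implicit Types A B : bop V.

HB.instance Definition _ := [isSub for @bop_fun R V].
HB.instance Definition _ := [Choice of bop V by <:].
HB.instance Definition _ := [SubChoice_isSubLmodule of bop V by <:].

Let bopnorm A : R[i] := (opnorm A)%:C.

Lemma opnormD A B : opnorm (A + B : bop V) <= opnorm A + opnorm B.
Proof.
apply: opnorm_le => [|x]; first by rewrite addr_ge0 ?opnorm_ge0 ?bop_funP.
rewrite (le_trans (rnormD _ _))// mulrDl.
by rewrite lerD// opnormP// bop_funP.
Qed.

Let bopnormD A B : bopnorm (A + B) <= bopnorm A + bopnorm B.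
Proof. by rewrite -rmorphD lecR opnormD. Qed.

Let opnormZ_le (l : R[i]) A : opnorm (l *: A : bop V) <= complex.Re `|l| * opnorm A.
Proof.
have l0 : 0 <= complex.Re `|l| by rewrite -ler0c RRe_real ?normr_real.
apply: opnorm_le => [|x]; first by rewrite mulr_ge0 ?opnorm_ge0 ?bop_funP.
by rewrite [leLHS]rnormZ -mulrA ler_wpM2l// opnormP// bop_funP.
Qed.

Lemma opnorm_eq0 A : opnorm A = 0 -> A = 0.
Proof.
move=> A0; apply/val_inj/funext => x /=; apply/rnorm_eq0/eqP.
rewrite eq_le rnorm_ge0 andbT.
by have := @opnormP _ _ A x (bop_funP A); rewrite A0 mul0r.
Qed.

Lemma opnorm0 : opnorm (0 : bop V) = 0.
Proof.
apply/eqP; rewrite eq_le opnorm_ge0 ?bop_funP// andbT.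
by apply: opnorm_le => // x; rewrite /= [X in X <= _]rnorm0 mul0r.
Qed.

Lemma opnormZ (l : R[i]) A : opnorm (l *: A : bop V) = complex.Re `|l| * opnorm A.
Proof.
have [->|l0] := eqVneq l 0; first by rewrite scale0r opnorm0 normr0 mul0r.
apply/eqP; rewrite eq_le opnormZ_le andTb.
have := opnormZ_le l^-1 (l *: A); rewrite scalerA mulVf// scale1r.
have lp : 0 < complex.Re `|l|.
  by rewrite -ltcR RRe_real ?normr_real ?normr_gt0.
have -> : complex.Re `|l^-1| = (complex.Re `|l|)^-1.
  apply: (@complexI R); rewrite RRe_real ?normr_real// normfV.
  by rewrite fmorphV; congr _^-1; rewrite -[LHS]RRe_real ?normr_real.
by rewrite ler_pdivlMl.
Qed.

Let bopnormZ (l : R[i]) A : bopnorm (l *: A) = `|l| * bopnorm A.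
Proof. by rewrite /bopnorm opnormZ rmorphM. Qed.

Let bopnorm_eq0 A : bopnorm A = 0 -> A = 0.
Proof. by move=> /(@complexI R)/opnorm_eq0. Qed.

HB.instance Definition _ :=
  Lmodule_isNormed.Build R[i] (bop V) bopnormD bopnormZ bopnorm_eq0.

Lemma bop_normE A : `|A| = (opnorm A)%:C.
Proof. by []. Qed.

End BoundedOperators.

Section LinearAlgebra.
Context {K : numDomainType} {V : lmodType K}.

Definition lin_indep n (v : 'I_n -> V) :=
  forall c : 'I_n -> K, \sum_i c i *: v i = 0 -> forall i, c i = 0.

(* Hamel dimension of the subspace [E], as an element of [0, +oo]: the supremum
   of the sizes of the linearly independent families in [E]. *)
Definition dimension (R : realType) (E : set V) : \bar R :=
  ereal_sup [set n%:R%:E | n in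
    [set n | exists v : 'I_n -> V, lin_indep v /\ forall i, E (v i)]].

Definition op_eigenspace (A : V -> V) (l : K) : set V := [set x | A x = l *: x].

Definition op_eigenvalue (A : V -> V) (l : K) :=
  exists2 x, op_eigenspace A l x & x != 0.

End LinearAlgebra.

Section Operators.
Context {R : realType} {H : hilbertType R}.
Implicit Type A : H -> H.

Definition self_adjoint A := forall x y, hdot (A x) y = hdot x (A y).

Definition finite_rank A := (dimension R (range A) < +oo)%E.

(* Numbers of positive and of negative eigenvalues, each eigenvalue being counted
   with its multiplicity, the dimension of its eigenspace. In [R[i]], [0 < l]
   and [l < 0] entail that [l] is real. *)
Definition num_pos_eigenvalues A : \bar R :=
  (\esum_(l in [set l | op_eigenvalue A l /\ (0 < l)%R])
     dimension R (op_eigenspace A l))%E.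

Definition num_neg_eigenvalues A : \bar R :=
  (\esum_(l in [set l | op_eigenvalue A l /\ (l < 0)%R])
     dimension R (op_eigenspace A l))%E.

End Operators.

Definition causal_set {R : realType} (H : hilbertType R) (s : nat) : set (bop H) :=
  [set A : bop H | [/\ self_adjoint A, finite_rank A,
    (num_pos_eigenvalues A <= s%:R%:E)%E & (num_neg_eigenvalues A <= s%:R%:E)%E]].
Arguments causal_set {R} H s _.

Definition causal_ops {R : realType} (H : hilbertType R) (s : nat) : Type :=
  set_type (causal_set H s).

Section CausalMetric.
Context {R : realType} {H : hilbertType R} {s : nat}.
Local Notation F := (causal_ops H s).

(* [F] carries the uniform structure, hence the topology, of a subspace of L(H);
   [opdist] is then shown to be a metric inducing this structure. *)
HB.instance Definition _ := Uniform.copy F (set_type (causal_set H s)).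

Definition opdist (A B : F) : R := opnorm (val A - val B : bop H).

Let opball (A : F) (r : R) : set F := [set B | opdist A B < r].

Let opdist0 A : opdist A A = 0.
Proof. by rewrite /opdist subrr opnorm0. Qed.

Let opdist_sym A B : opdist A B = opdist B A.
Proof. by apply: (@complexI R); rewrite /opdist -!bop_normE distrC. Qed.

Let opdist_triangle B A C : opdist A C <= opdist A B + opdist B C.
Proof. by rewrite /opdist -(subrKA (val B)) opnormD. Qed.

Let opball_center A (e : R) : 0 < e -> opball A e A.
Proof. by rewrite /opball/= opdist0. Qed.

Let opball_sym A B (e : R) : opball A e B -> opball B e A.
Proof. by rewrite /opball/= opdist_sym. Qed.

Let opball_triangle A B C (e f : R) :
  opball A e B -> opball B f C -> opball A (e + f) C.
Proof.
move=> AB BC; exact: le_lt_trans (opdist_triangle B A C) (ltrD AB BC).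
Qed.

Let opball_entourage : entourage = entourage_ opball.
Proof.
apply/seteqP; split => P.
- move=> [Q]; rewrite -entourage_ballE => -[e /= e0 eQ] QP.
  exists (complex.Re e); first by move: e0; rewrite ltcE => /andP[].
  move=> [A B] /= AB; apply/QP/eQ => /=; rewrite -ball_normE/= bop_normE.
  by rewrite -[e]RRe_real ?gtr0_real// ltcR.
- move=> [e /= e0 eP].
  exists [set X : bop H * bop H | ball X.1 e%:C X.2].
    by rewrite -entourage_ballE; exists e%:C => //=; rewrite ltcR.
  move=> [A B] /= AB; apply: eP => /=; rewrite /opball/= -ltcR /opdist -bop_normE.
  by move: AB; rewrite -ball_normE.
Qed.

HB.instance Definition _ := Uniform_isPseudoMetric.Build R F
  opball_center opball_sym opball_triangle opball_entourage.

Let opdist_ge0 A B : 0 <= opdist A B.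
Proof. exact/opnorm_ge0/bop_funP. Qed.

Let opdist_eq0 A B : opdist A B = 0 -> A = B.
Proof. by move=> /opnorm_eq0/eqP; rewrite subr_eq0 => /eqP/val_inj. Qed.

HB.instance Definition _ := PseudoMetric_isMetric.Build R F
  opdist_ge0 opdist_eq0 (fun _ _ => erefl).

Lemma causal_mdistE (A B : F) : mdist A B = opnorm (val A - val B : bop H).
Proof. by []. Qed.

End CausalMetric.

Definition separable_space (T : topologicalType) :=
  exists2 D : set T, countable D & dense D.

(* The property required by the library's [Uniform_isComplete], without its
   pointedness requirement. *)
Definition complete_space (T : uniformType) :=
  forall G : set_system T, ProperFilter G -> cauchy G -> exists x : T, G --> x.

Definition separable_complete_metric (R : realType) (M : metricType R) :=
  separable_space M /\ complete_space M.

Definition homeomorphic (T U : topologicalType) :=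
  exists f : T -> U, exists2 g : U -> T,
    cancel f g /\ cancel g f & continuous f /\ continuous g.

Definition polish (R : realType) (T : topologicalType) :=
  exists2 M : metricType R, separable_complete_metric M & homeomorphic T M.

(* Main.v *)
Require Import Defs.
From HB Require Import structures.
From mathcomp Require Import all_boot all_order all_algebra.
From mathcomp Require Import complex ring lra.
From mathcomp Require Import all_classical all_reals all_analysis.

(** A self-adjoint operator [A] of finite rank has at most [s] positive
    eigenvalues iff the form [<Ax, x>] is positive definite on no subspace of
    dimension s+1 (likewise for the negative ones and [-<Ax, x>]), and it has
    rank at most 2s iff [<Ax, Ax>] is positive definite on no subspace of
    dimension 2s+1. Positive definiteness on a given finite-dimensional subspace
    survives small perturbations, so these conditions are closed for the
    operator norm; as a Cauchy filter of bounded operators has a bounded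
    pointwise limit, F is complete. By the spectral theorem the elements of F
    are exactly the operators
    [sum_(i < s) <., f_i> f_i - sum_(i < s) <., g_i> g_i]; this expression is
    continuous in the vectors [f_i], [g_i], so letting them range over a
    countable dense subset of H yields a countable dense subset of F. *)

Set Implicit Arguments.
Unset Strict Implicit.
Unset Printing Implicit Defensive.

Import Order.TTheory GRing.Theory Num.Theory.
Import numFieldNormedType.Exports.

Local Open Scope classical_set_scope.
Local Open Scope ring_scope.

(** * Linear combinations, independence and finite dimension *)

Lemma nontrivial_left_kernel (K : fieldType) k p (M : 'M[K]_(k, p)) :
  (p < k)%N -> exists2 c : 'rV[K]_k, c != 0 & c *m M = 0.
Proof.
move=> pk; have : kermx M != 0.
  by rewrite -mxrank_eq0 mxrank_ker -lt0n subn_gt0 (leq_ltn_trans (rank_leq_col _)).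
by move=> /rowV0Pn[c /sub_kermxP cM c0]; exists c.
Qed.

(** Otherwise induction would reach [m.+1]. This is how families of maximal size are obtained
    below. *)
Lemma exists_last (P : nat -> Prop) m : P 0%N -> (forall k, P k -> (k <= m)%N) ->
  exists2 k, P k & ~ P k.+1.
Proof.
move=> P0 Pm; apply: contrapT => nP.
have Pk k : P k.
  by elim: k => // k Pk; apply: contrapT => nPk; apply: nP; exists k.
by have := Pm _ (Pk m.+1); rewrite ltnn.
Qed.

Section LinearCombinations.
Context {K : numFieldType} {V : lmodType K}.

Definition lincomb n (v : 'I_n -> V) (c : 'rV[K]_n) : V := \sum_i c 0 i *: v i.

Lemma lincomb_is_linear n (v : 'I_n -> V) : linear (lincomb v).
Proof.
move=> a c d; rewrite /lincomb scaler_sumr -big_split/=; apply: eq_bigr => i _.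
by rewrite !mxE scalerDl scalerA.
Qed.

HB.instance Definition _ n (v : 'I_n -> V) :=
  GRing.isLinear.Build K 'rV[K]_n V _ (lincomb v) (lincomb_is_linear v).

Lemma lincombZ n (v : 'I_n -> V) a c : lincomb v (a *: c) = a *: lincomb v c.
Proof. exact: (linearZ_LR (lincomb v)). Qed.

Lemma lincomb_mulmx m n (v : 'I_n -> V) (c : 'rV[K]_m) (M : 'M[K]_(m, n)) :
  lincomb v (c *m M) = lincomb (fun i => lincomb v (row i M)) c.
Proof.
rewrite {2}/lincomb mulmx_sum_row raddf_sum/=; apply: eq_bigr => i _.
exact: lincombZ.
Qed.

Lemma linear_lincomb (A : V -> V) n (v : 'I_n -> V) c : linear A ->
  A (lincomb v c) = lincomb (fun i => A (v i)) c.
Proof.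
move=> lA; pose A' := HB.pack_for {linear V -> V} A
  (GRing.isLinear.Build K V V _ A lA).
rewrite -[A]/(A' : V -> V) raddf_sum; apply: eq_bigr => i _.
exact: (linearZ_LR A').
Qed.

Lemma lin_indepP n (v : 'I_n -> V) :
  lin_indep v <-> forall c, lincomb v c = 0 -> c = 0.
Proof.
split=> [lv c vc|lv c vc i].
  by apply/rowP => i; rewrite mxE; apply: lv vc i.
have := lv (\row_j c j); rewrite /lincomb.
under eq_bigr do rewrite mxE.
by move=> /(_ vc)/rowP/(_ i); rewrite !mxE.
Qed.

Definition family_cons n (x : V) (v : 'I_n -> V) : 'I_n.+1 -> V :=
  fun i => oapp v x (unlift ord0 i).

Lemma lincomb_cons n x (v : 'I_n -> V) c :
  lincomb (family_cons x v) c =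
  c 0 0 *: x + lincomb v (\row_i c 0 (lift ord0 i)).
Proof.
rewrite /lincomb big_ord_recl /family_cons unlift_none; congr (_ + _).
by apply: eq_bigr => i _; rewrite liftK !mxE.
Qed.

Lemma family_consP n (x : V) (v : 'I_n -> V) (P : V -> Prop) :
  P x -> (forall i, P (v i)) -> forall i, P (family_cons x v i).
Proof. by move=> Px Pv i; rewrite /family_cons; case: unliftP => [j|] /= _. Qed.

Lemma lin_indep_cons n x (v : 'I_n -> V) : lin_indep v ->
  (forall c, x <> lincomb v c) -> lin_indep (family_cons x v).
Proof.
move=> /lin_indepP lv xv; apply/lin_indepP => c.
rewrite lincomb_cons => /eqP; rewrite addrC addr_eq0 => /eqP vc.
have [c0|c0] := eqVneq (c 0 0) 0.
  move: vc; rewrite c0 scale0r oppr0 => /lv/rowP cv.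
  apply/rowP => i; rewrite !mxE; case: (unliftP ord0 i) => [j ->|->//].
  by have := cv j; rewrite !mxE.
case: (xv (- (c 0 0)^-1 *: \row_i c 0 (lift ord0 i))).
by rewrite lincombZ vc scalerN scaleNr opprK scalerA mulVf// scale1r.
Qed.

Lemma dimension_ge (R : realType) (E : set V) n (v : 'I_n -> V) :
  lin_indep v -> (forall i, E (v i)) -> (n%:R%:E <= dimension R E)%E.
Proof. by move=> lv Ev; apply: ereal_sup_ubound; exists n => //; exists v. Qed.

(** The coordinates in [e] form an [n] by [m] matrix; if [m < n], a nonzero vector of its left
    kernel is a linear relation between the [v i]. *)
Lemma lin_indep_size n m (v : 'I_n -> V) (e : 'I_m -> V) :
  lin_indep v -> (forall i, exists c, v i = lincomb e c) -> (n <= m)%N.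
Proof.
move=> /lin_indepP lv /choice[c vc]; rewrite leqNgt; apply/negP => mn.
have [d d0 dM] := nontrivial_left_kernel (\matrix_i c i) mn.
move/eqP: d0; apply; apply: lv.
have -> : v = (fun i => lincomb e (row i (\matrix_i c i))).
  by apply/funext => i; rewrite rowK.
by rewrite -lincomb_mulmx dM linear0.
Qed.

Lemma dimension_le (R : realType) (E : set V) m (e : 'I_m -> V) :
  (forall x, E x -> exists c, x = lincomb e c) -> (dimension R E <= m%:R%:E)%E.
Proof.
move=> Ee; apply: ub_ereal_sup => _ [n [v [lv Ev]] <-].
by rewrite lee_fin ler_nat; apply: lin_indep_size lv _ => i; exact: (Ee _ (Ev i)).
Qed.

(** The bound lives in [nat], so that [exists_last] can extract a maximal independent family, that
    is, a basis. *)
Definition finite_dim (E : set V) := exists m, forall n (v : 'I_n -> V),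
  lin_indep v -> (forall i, E (v i)) -> (n <= m)%N.

Lemma dimension_lty (R : realType) (E : set V) : (dimension R E < +oo)%E ->
  finite_dim E.
Proof.
(* The empty family makes the supremum nonnegative, hence a finite number, and an Archimedean bound
   of it serves as [m]. *)
move=> Efin; have E0 : (0%:E <= dimension R E)%E.
  apply: (@dimension_ge _ _ 0%N (fun=> 0)); last by case.
  by move=> c _ [].
have : dimension R E \is a fin_num by rewrite ge0_fin_numE.
move=> /fineK En; exists (Num.bound (fine (dimension R E))) => n v lv Ev.
have := dimension_ge R lv Ev; rewrite -En lee_fin -(ler_nat R) => /le_trans; apply.
by rewrite ltW// archi_boundP// fine_ge0.
Qed.

Lemma finite_dimS (E F : set V) : E `<=` F -> finite_dim F -> finite_dim E.
Proof. by move=> EF [m mF]; exists m => n v lv Ev; apply: mF lv _ => i; apply/EF. Qed.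

Lemma finite_dim_basis (E : set V) : finite_dim E -> exists n (v : 'I_n -> V),
  [/\ lin_indep v, forall i, E (v i) & forall x, E x -> exists c, x = lincomb v c].
Proof.
move=> [m Em].
pose P n := exists v : 'I_n -> V, lin_indep v /\ forall i, E (v i).
have [||n [v [lv Ev]] nP] := @exists_last P m.
- by exists (fun=> 0); split=> [c _ []//|[]//].
- by move=> k [v [lv /(Em _ _ lv)]].
exists n, v; split => // x Ex; apply: contrapT => nx; apply: nP.
exists (family_cons x v); split; last exact: family_consP.
by apply: lin_indep_cons => // c xc; apply: nx; exists c.
Qed.

End LinearCombinations.

(** In a basis of [E] the operator becomes a matrix of positive size, which has an eigenvalue over a
    closed field. Coordinates are row vectors, so a left eigenvector of this matrix gives an
    eigenvector of [A]. *)
Lemma stable_eigenvector (C : numClosedFieldType) (V : lmodType C)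
    (A : V -> V) (E : set V) (w : V) : linear A -> finite_dim E ->
  (forall n (v : 'I_n -> V) c, (forall i, E (v i)) -> E (lincomb v c)) ->
  (forall x, E x -> E (A x)) -> E w -> w != 0 ->
  exists u l, [/\ E u, u != 0 & A u = l *: u].
Proof.
move=> lA /finite_dim_basis[n [v [/lin_indepP lv Ev vE]]] Elin EA Ew w0.
have n0 : (0 < n)%N.
  case: n v lv Ev vE => // v _ _ /(_ w Ew)[c wc].
  by move: w0; rewrite wc /lincomb big_ord0 eqxx.
have /choice[c Ac] : forall i, exists c, A (v i) = lincomb v c.
  by move=> i; exact/vE/EA.
have [l /eigenvalueP[d dM d0]] := eigenvalue_closed (\matrix_i c i) n0.
exists (lincomb v d), l; split; first exact: Elin.
  by apply: contra_neq d0 => /lv.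
rewrite linear_lincomb// -lincombZ -dM lincomb_mulmx; congr lincomb.
by apply/funext => i; rewrite rowK.
Qed.

Lemma lincomb_closed (K : numFieldType) (V : lmodType K) (E : set V) :
  E 0 -> (forall a x y, E x -> E y -> E (a *: x + y)) ->
  forall n (v : 'I_n -> V) c, (forall i, E (v i)) -> E (lincomb v c).
Proof.
move=> E0 EP n v c Ev; apply: (@big_ind _ E) => // [x y Ex Ey|i _].
  by rewrite -[x]scale1r; exact: EP.
by rewrite -[_ *: _]addr0; exact: EP.
Qed.

(** * Hermitian forms and orthonormal families *)

Section HermitianForm.
Context {C : numClosedFieldType} {V : lmodType C}.
Implicit Types b : V -> V -> C.

(** Indefinite and degenerate forms are included: besides the inner product, the forms ['[B x, y]],
    [- '[B x, y]] and ['[B x, B y]] are treated. *)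
Definition hermitian_form b :=
  (forall z, scalar (b^~ z)) /\ forall x y, b y x = (b x y)^*.

Definition orthonormal_family b n (e : 'I_n -> V) :=
  forall i j, b (e i) (e j) = (i == j)%:R.

Section Form.
Context (b : V -> V -> C) (hb : hermitian_form b).

Lemma herm0l z : b 0 z = 0.
Proof.
have [lb _] := hb; have := lb z (-1) 0 0.
by rewrite scaler0 addr0 mulN1r addNr.
Qed.

Lemma hermZl a x z : b (a *: x) z = a * b x z.
Proof. by have [lb _] := hb; rewrite -[a *: x]addr0 lb herm0l addr0. Qed.

Lemma hermDl x y z : b (x + y) z = b x z + b y z.
Proof. by have [lb _] := hb; rewrite -[x in LHS]scale1r lb mul1r. Qed.

Lemma herm_lincombl n (v : 'I_n -> V) c z :
  b (lincomb v c) z = \sum_i c 0 i * b (v i) z.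
Proof.
rewrite (big_morph (b^~ z) (fun x y => hermDl x y z) (herm0l z)).
by apply: eq_bigr => i _; rewrite hermZl.
Qed.

Lemma herm_lincomb_delta n (e : 'I_n -> V) c i : orthonormal_family b e ->
  b (lincomb e c) (e i) = c 0 i.
Proof.
move=> oe; rewrite herm_lincombl (bigD1 i)//= oe eqxx mulr1 big1 ?addr0// => j.
by move=> /negPf ji; rewrite oe ji mulr0.
Qed.

Lemma herm_lincomb n (e : 'I_n -> V) c : orthonormal_family b e ->
  b (lincomb e c) (lincomb e c) = \sum_i `|c 0 i| ^+ 2.
Proof.
move=> oe; rewrite herm_lincombl; apply: eq_bigr => i _.
by have [_ ->] := hb; rewrite herm_lincomb_delta// normCK.
Qed.

Lemma herm_real x : b x x \is Num.real.
Proof. by have [_ bC] := hb; rewrite CrealE -bC. Qed.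

Lemma orthonormal_lin_indep n (e : 'I_n -> V) :
  orthonormal_family b e -> lin_indep e.
Proof.
move=> oe; apply/lin_indepP => c ec; apply/rowP => i.
by rewrite -(herm_lincomb_delta c i oe) ec herm0l mxE.
Qed.

(** These are [p] linear equations in [k > p] unknown coefficients. Both the Gram-Schmidt process
    and the index bounds rest on this count. *)
Lemma lincomb_orthogonal k p (v : 'I_k -> V) (f : 'I_p -> V) : (p < k)%N ->
  exists2 c, c != 0 & forall j, b (lincomb v c) (f j) = 0.
Proof.
move=> pk.
have [c c0 /rowP cM] := nontrivial_left_kernel (\matrix_(i, j) b (v i) (f j)) pk.
exists c => // j; have := cM j; rewrite !mxE => <-.
by rewrite herm_lincombl; apply: eq_bigr => i _; rewrite mxE.
Qed.

Lemma orthonormal_cons n x (e : 'I_n -> V) : orthonormal_family b e ->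
  0 < b x x -> (forall i, b x (e i) = 0) ->
  orthonormal_family b (family_cons ((sqrtC (b x x))^-1 *: x) e).
Proof.
move=> oe x0 xe; have [_ bC] := hb; set y := _ *: x.
have ye i : b y (e i) = 0 by rewrite hermZl xe mulr0.
have y1 : b y y = 1.
  have r0 : (sqrtC (b x x))^-1 \is Num.real by rewrite realV sqrtC_real ?ltW.
  rewrite hermZl (bC y x) hermZl rmorphM/= (conj_Creal r0) -bC mulrA -expr2 exprVn.
  by rewrite sqrtCK mulVf// gt_eqF.
move=> i j; rewrite /family_cons.
case: unliftP => [i'|] ->; case: unliftP => [j'|] -> //=.
by rewrite bC ye conjC0.
Qed.

(** Gram-Schmidt by counting: as long as [k < n], some nonzero combination of the [v i] is
    orthogonal to the [k] vectors found so far, and it can be normalised. *)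
Lemma exists_orthonormal_family n (v : 'I_n -> V) :
  (forall c, c != 0 -> 0 < b (lincomb v c) (lincomb v c)) ->
  exists e : 'I_n -> V, orthonormal_family b e.
Proof.
move=> v_pos; suff E k : (k <= n)%N -> exists e : 'I_k -> V, orthonormal_family b e.
  exact: E.
elim: k => [_|k IHk kn]; first by exists (fun=> 0); case.
have [e oe] := IHk (ltnW kn); have [c c0 ce] := lincomb_orthogonal v e kn.
by eexists; apply: orthonormal_cons oe (v_pos c c0) ce.
Qed.

End Form.
End HermitianForm.

(** * The inner product and the spectral theorem in finite rank *)

Local Notation "''[' x , y ]" := (hdot x y).

Section Hdot.
Context {R : realType} {H : hilbertType R}.
Local Notation C := R[i].
Implicit Types x y z : H.

Lemma hdotDl x y z : '[x + y, z] = '[x, z] + '[y, z].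
Proof. exact: linearDl. Qed.

Lemma hdotBl x y z : '[x - y, z] = '[x, z] - '[y, z].
Proof. exact: linearBl. Qed.

Lemma hdotBr x y z : '[x, y - z] = '[x, y] - '[x, z].
Proof. exact: linearBr. Qed.

Lemma hdotNl x y : '[- x, y] = - '[x, y].
Proof. exact: linearNl. Qed.

Lemma hdotZl a x y : '[a *: x, y] = a * '[x, y].
Proof. exact: linearZl_LR. Qed.

Lemma hdotZr a x y : '[x, a *: y] = a^* * '[x, y].
Proof. exact: linearZr_LR. Qed.

Lemma hdot0l x : '[0, x] = 0.
Proof. by rewrite -(scale0r (0 : H)) hdotZl mul0r. Qed.

Lemma hdot0r x : '[x, 0] = 0.
Proof. by rewrite -(scale0r (0 : H)) hdotZr conjC0 mul0r. Qed.

Lemma hdotC x y : '[y, x] = '[x, y]^*.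
Proof. by rewrite (hermC (@hdot R H)) mul1r. Qed.

Lemma hdot_suml I (r : seq I) (P : pred I) (v : I -> H) y :
  '[\sum_(i <- r | P i) v i, y] = \sum_(i <- r | P i) '[v i, y].
Proof. exact: linear_sumlz. Qed.

Lemma hdot_sumr I (r : seq I) (P : pred I) (v : I -> H) y :
  '[y, \sum_(i <- r | P i) v i] = \sum_(i <- r | P i) '[y, v i].
Proof. exact: linear_sumr. Qed.

Lemma hdotxx x : '[x, x] = ((rnorm x) ^+ 2)%:C%C.
Proof. by rewrite hdot_norm rnormE rmorphXn. Qed.

Lemma hdot_ge0 x : 0 <= '[x, x].
Proof. by rewrite hdotxx ler0c sqr_ge0. Qed.

Lemma hdot_eq0 x : ('[x, x] == 0) = (x == 0).
Proof. by rewrite hdot_norm expf_eq0/= normr_eq0. Qed.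

Lemma hdot_gt0 x : (0 < '[x, x]) = (x != 0).
Proof. by rewrite lt_def hdot_ge0 andbT hdot_eq0. Qed.

Lemma hdot_CauchySchwarz x y : `|'[x, y]| <= `|x| * `|y|.
Proof.
rewrite -(@ler_pXn2r _ 2)// ?nnegrE ?mulr_ge0// exprMn -!hdot_norm.
have [->|y0] := eqVneq y 0; first by rewrite hdot0r normr0 expr0n hdot0r mulr0.
have yp : 0 < '[y, y] by rewrite hdot_gt0.
(* The component of [x] orthogonal to [y] has a nonnegative square. *)
rewrite -ler_pdivrMr//; have := hdot_ge0 (x - ('[x, y] / '[y, y]) *: y).
rewrite hdotBr hdotZr !hdotBl !hdotZl divfK ?gt_eqF// subrr mulr0 subr0.
by rewrite [X in _ * X]hdotC normCK subr_ge0 mulrAC.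
Qed.

Lemma hdot_hermitian : hermitian_form (@hdot R H).
Proof. by split=> [z a x y|x y]; [rewrite hdotDl hdotZl | exact: hdotC]. Qed.

(** Only the nonzero eigenvalues are listed, repeated by multiplicity; the family is thus finite
    even if the kernel of [A] has infinite dimension. *)
Definition spectral_decomposition (A : H -> H) n (e : 'I_n -> H) (l : 'I_n -> C) :=
  [/\ orthonormal_family hdot e, forall i, l i != 0 /\ l i \is Num.real &
    forall x, A x = \sum_i (l i * '[x, e i]) *: e i].

Lemma self_adjoint_eigenvalue_real (A : H -> H) u l : self_adjoint A ->
  u != 0 -> A u = l *: u -> l \is Num.real.
Proof.
move=> sA u0 Au; rewrite CrealE; have := sA u u.
by rewrite Au hdotZl hdotZr => /mulIf lE; rewrite -lE ?eqxx// hdot_eq0.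
Qed.

(* A maximal orthonormal family of eigenvectors with nonzero eigenvalues spans
   the range: its orthogonal complement is stable and contains no further
   eigenvector of nonzero eigenvalue, so [A] vanishes there. *)
Lemma spectral_theorem (A : H -> H) : linear A -> self_adjoint A ->
  finite_rank A -> exists n (e : 'I_n -> H) l, spectral_decomposition A e l.
Proof.
move=> lA sA /dimension_lty rA.
pose P n := exists (e : 'I_n -> H) (l : 'I_n -> C), orthonormal_family hdot e /\
  forall i, l i != 0 /\ A (e i) = l i *: e i.
(* Eigenvectors with nonzero eigenvalue lie in the range, so the rank bounds the size of the
   family. *)
have [m Pm] : exists m, forall k, P k -> (k <= m)%N.
  have [m rAm] := rA; exists m => k [e [l [oe le]]].
  apply: (rAm _ e); first exact: (orthonormal_lin_indep hdot_hermitian).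
  move=> i; have [l0 Ae] := le i; exists ((l i)^-1 *: e i) => //.
  by rewrite linear_atZ// Ae scalerA mulVf// scale1r.
have P0 : P 0%N.
  by exists (fun=> 0), (fun=> 0); split; [case|move=> []].
have [n [e [l [oe le]]] nP] := exists_last P0 Pm.
exists n, e, l.
have lr i : l i \is Num.real.
  apply: (@self_adjoint_eigenvalue_real A (e i)) => //; last by case: (le i).
  by rewrite -hdot_eq0 oe eqxx oner_neq0.
split=> // [i|]; first by split=> //; case: (le i).
(* Intersecting the orthogonal complement with the range makes it finite-dimensional, as
   [stable_eigenvector] requires. *)
pose W : set H := [set x | range A x /\ forall i, '[x, e i] = 0].
have A0 x : (forall i, '[x, e i] = 0) -> A x = 0.
  move=> xe; apply: contrapT => /eqP Ax0.
  have AW y : (forall i, '[y, e i] = 0) -> W (A y).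
    move=> ye; split=> [|i]; first by exists y.
    by have [_ Ae] := le i; rewrite sA Ae hdotZr ye mulr0.
  have [||y|||u [a [[[y _ yu] ue] u0 Au]]] := @stable_eigenvector C H A W (A x) lA.
  - by apply: finite_dimS rA => ? [].
  - apply: lincomb_closed.
      split=> [|i]; last by rewrite hdot0l.
      by exists 0 => //; rewrite linear_at0.
    move=> a _ _ [[y _ <-] ye] [[z _ <-] ze]; split=> [|i].
      by exists (a *: y + z) => //; rewrite lA.
    by rewrite hdotDl hdotZl ye ze mulr0 addr0.
  - by move=> [_ /AW].
  - exact: AW.
  - exact: Ax0.
  (* Here [u = A y], so [a = 0] would give ['[u, u] = '[y, A u] = 0]. *)
  have a0 : a != 0.
    apply: contra_neq u0 => a0; apply/eqP; rewrite -hdot_eq0 -{1}yu sA Au a0.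
    by rewrite scale0r hdot0r.
  apply: nP; exists (family_cons ((sqrtC '[u, u])^-1 *: u) e).
  exists (fun i => oapp l a (unlift ord0 i)); split.
    by apply: (orthonormal_cons hdot_hermitian) => //; rewrite hdot_gt0.
  move=> i; rewrite /family_cons; case: unliftP => [j _|_] /=; first exact: le.
  by rewrite linear_atZ// Au !scalerA mulrC.
(* [y] is the orthogonal projection of [x] onto the span of [e], and [A] kills the remainder. *)
move=> x; pose y := lincomb e (\row_i '[x, e i]).
have : A (x - y) = 0.
  by apply: A0 => i; rewrite hdotBl (herm_lincomb_delta hdot_hermitian)// mxE subrr.
rewrite -[x - y]addrC -scaleN1r lA scaleN1r => /eqP; rewrite addrC subr_eq0 => /eqP->.
rewrite linear_lincomb//; apply: eq_bigr => i _; rewrite mxE.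
by have [_ ->] := le i; rewrite scalerA mulrC.
Qed.

End Hdot.

(** * Eigenvalue counts and index conditions on quadratic forms *)

Lemma lin_indep_comp (K : numFieldType) (V : lmodType K) k n (v : 'I_n -> V)
    (f : 'I_k -> 'I_n) : injective f -> lin_indep v -> lin_indep (v \o f).
Proof.
move=> finj lv c vc i.
have := lv (fun j => \sum_(i | f i == j) c i).
have -> : \sum_j (\sum_(i | f i == j) c i) *: v j = \sum_i c i *: v (f i).
  rewrite [RHS](partition_big f xpredT)//=; apply: eq_bigr => j _.
  by rewrite scaler_suml; apply: eq_bigr => i' /eqP ->.
move=> /(_ vc (f i)); rewrite (bigD1 i)//= big1 ?addr0// => j /andP[/eqP/finj->].
by rewrite eqxx.
Qed.

Section Characterization.
Context {R : realType} {H : hilbertType R}.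
Local Notation C := R[i].

Section Count.
Context (A : H -> H) (n : nat) (e : 'I_n -> H) (l : 'I_n -> C).
Hypothesis Ael : spectral_decomposition A e l.

Lemma spectral_eigenvector i : A (e i) = l i *: e i.
Proof.
have [oe _ ->] := Ael; rewrite (bigD1 i)//= oe eqxx mulr1 big1 ?addr0// => j ji.
by rewrite oe eq_sym (negPf ji) mulr0 scale0r.
Qed.

Lemma spectral_linear : linear A.
Proof.
have [_ _ AE] := Ael; move=> a x y; rewrite !AE scaler_sumr -big_split/=.
apply: eq_bigr => i _; rewrite scalerA -scalerDl hdotDl hdotZl mulrDr.
by rewrite mulrCA.
Qed.

Lemma orthonormal_comp k (f : 'I_k -> 'I_n) : injective f ->
  orthonormal_family hdot (fun i => e (f i)).
Proof. by have [oe _ _] := Ael => finj i j; rewrite oe (inj_eq finj). Qed.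

(** The [e i] with [l i = a] form a basis of the eigenspace. The value [0] is excluded because the
    kernel is orthogonal to every [e i]. *)
Lemma dimension_eigenspace (a : C) : a != 0 ->
  dimension R (op_eigenspace A a) = #|[pred i | l i == a]|%:R%:E.
Proof.
move=> a0; have [oe _ AE] := Ael; apply/eqP; rewrite eq_le; apply/andP; split.
  apply: (@dimension_le _ _ R _ _ (fun k : 'I_#|[pred i | l i == a]| => e (enum_val k))).
  move=> x Ax; exists (\row_k '[x, e (enum_val k)]).
  transitivity (\sum_(i | l i == a) '[x, e i] *: e i); last first.
    by rewrite big_enum_val/= /lincomb; apply: eq_bigr => k _; rewrite mxE.
  apply: (scalerI a0); rewrite -[LHS]Ax AE scaler_sumr [RHS]big_mkcond/=.
  apply: eq_bigr => i _; case: ifPn => [/eqP->|li]; first by rewrite scalerA.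
  (* Compare the components of [A x = a *: x] along [e i]. *)
  have : a * '[x, e i] = l i * '[x, e i].
    rewrite -hdotZl -[X in '[X, _]]Ax AE hdot_suml (bigD1 i)//= hdotZl oe eqxx mulr1.
    by rewrite big1 ?addr0// => j /negPf ji; rewrite hdotZl oe ji mulr0.
  move/eqP; rewrite -subr_eq0 -mulrBl mulf_eq0 subr_eq0 eq_sym (negPf li)/=.
  by move=> /eqP ->; rewrite mulr0 scale0r.
apply: (@dimension_ge _ _ R _ _ (fun k : 'I_#|[pred i | l i == a]| => e (enum_val k))).
  exact/(orthonormal_lin_indep hdot_hermitian)/orthonormal_comp/enum_val_inj.
move=> k; rewrite /op_eigenspace/= spectral_eigenvector.
by have := enum_valP k; rewrite inE => /eqP ->.
Qed.

(** Each dimension is a sum over [i] of indicators of [l i = a]. After exchanging the sums, an index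
    with [P (l i)] counts once, at [a = l i], and the others not at all. *)
Lemma esum_dimension_eigenspace (P : pred C) : ~~ P 0 ->
  (\esum_(a in [set a | op_eigenvalue A a /\ P a])
     dimension R (op_eigenspace A a))%E = #|[pred i | P (l i)]|%:R%:E.
Proof.
move=> P0; set S := [set a | _].
have -> : (\esum_(a in S) dimension R (op_eigenspace A a) =
    \esum_(a in S) \sum_(i < n) ((l i == a)%:R%:E : \bar R))%E.
  apply: eq_esum => a [_ Pa]; rewrite dimension_eigenspace.
    by rewrite -sum1_card natr_sum -sumEFin big_mkcond/=; apply: eq_bigr => i _;
      rewrite inE; case: eqP.
  by apply: contraNneq P0 => <-.
rewrite esum_sum => [|a i _ _]; last by rewrite lee_fin.
rewrite -sum1_card natr_sum -sumEFin [RHS]big_mkcond/=; apply: eq_bigr => i _.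
rewrite inE; case: ifPn => Pl.
  have -> : (\esum_(a in S) (l i == a)%:R%:E =
      \esum_(a in S `&` [set l i]) (1%:E : \bar R))%E.
    rewrite [RHS]esum_mkcondr; apply: eq_esum => a _.
    rewrite eq_sym; have [->|ai] := eqVneq a (l i); first by rewrite ifT// inE.
    by rewrite ifF//; apply/negbTE; apply: contraNN ai; rewrite inE => /eqP.
  suff -> : S `&` [set l i] = [set l i] by rewrite esum_set1 // lee_fin.
  apply/setIidr => _ ->; split => //; exists (e i).
    by rewrite /op_eigenspace/= spectral_eigenvector.
  by have [oe _ _] := Ael; rewrite -hdot_eq0 oe eqxx oner_neq0.
apply: esum1 => a [_ Pa]; case: eqP => // la.
by rewrite la Pa in Pl.
Qed.

End Count.

(** The frame operator of the family [f], positive and of rank at most [s]. *)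
Definition gram_op s (f : 'I_s -> H) (x : H) : H := \sum_j '[x, f j] *: f j.

(** Each [e i] is scaled by the square root of its weight. The default [0] of [nth] fills the family
    up to exactly [s] vectors without changing the sum. *)
Lemma gram_op_pad s n (e : 'I_n -> H) (mu : 'I_n -> C) (P : pred 'I_n) :
  (forall i, P i -> 0 <= mu i) -> (#|P| <= s)%N ->
  exists f : 'I_s -> H, forall x,
    gram_op f x = \sum_(i | P i) (mu i * '[x, e i]) *: e i.
Proof.
move=> mu0 Ps; pose r := [seq sqrtC (mu i) *: e i | i <- enum P].
have rs : (size r <= s)%N by rewrite size_map -cardE.
exists (fun j => r`_j) => x.
transitivity (\sum_(y <- r) '[x, y] *: y).
  rewrite (big_nth 0) big_mkord (big_ord_widen s (fun j => '[x, r`_j] *: r`_j))//.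
  rewrite [RHS]big_mkcond; apply: eq_bigr => j _; case: ltnP => // rj.
  by rewrite nth_default// scaler0.
rewrite big_map big_enum/=; apply: eq_bigr => i Pi.
have m0 : sqrtC (mu i) \is Num.real by rewrite sqrtC_real// mu0.
by rewrite hdotZr (conj_Creal m0) scalerA mulrAC -expr2 sqrtCK.
Qed.

(** The spectral sum is split by the sign of [l i]; the two eigenvalue counts say that each half
    fits into [s] vectors. *)
Lemma causal_set_gram s (A : bop H) : causal_set H s A ->
  exists f g : 'I_s -> H, forall x, A x = gram_op f x - gram_op g x.
Proof.
move=> [sA rA pA nA]; have /bounded_opP[lA _] := bop_funP A.
have [n [e [l Ael]]] := spectral_theorem lA sA rA.
move: pA nA; rewrite /num_pos_eigenvalues /num_neg_eigenvalues.
rewrite (esum_dimension_eigenspace Ael (P := fun a => 0 < a)) ?ltxx//.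
rewrite (esum_dimension_eigenspace Ael (P := fun a => a < 0)) ?ltxx//.
rewrite !lee_fin !ler_nat => ps ns.
have [i|f fE] := @gram_op_pad s n e l [pred i | 0 < l i] _ ps; first exact: ltW.
have [i|g gE] := @gram_op_pad s n e (fun i => - l i) [pred i | l i < 0] _ ns.
  by rewrite oppr_ge0; exact: ltW.
exists f, g => x; have [_ lr ->] := Ael.
rewrite fE gE -sumrN (bigID (fun i => 0 < l i))/=; congr (_ + _).
apply: eq_big => [i|i _].
  by have [l0 li] := lr i; rewrite -real_leNgt ?real0// le_eqVlt (negPf l0).
by rewrite mulNr scaleNr opprK.
Qed.

(** If [q 0 <= 0], linearly dependent families satisfy this trivially, so it says that [q] is
    positive definite on no subspace of dimension [m + 1]. *)
Definition nonpos_index (q : H -> C) m :=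
  forall v : 'I_m.+1 -> H, exists2 c, c != 0 & q (lincomb v c) <= 0.

Lemma gram_op_orthogonal s (f : 'I_s -> H) x : (forall j, '[x, f j] = 0) ->
  gram_op f x = 0.
Proof. by move=> xf; apply: big1 => j _; rewrite xf scale0r. Qed.

Lemma gram_op_ge0 s (f : 'I_s -> H) x : 0 <= '[gram_op f x, x].
Proof.
rewrite hdot_suml sumr_ge0// => j _.
by rewrite hdotZl [X in _ * X]hdotC -normCK exprn_ge0.
Qed.

(** Some nontrivial combination of [s + 1] vectors is orthogonal to the [s] vectors [f j], which
    leaves only the negative part of the form. *)
Lemma nonpos_index_gram s (f g : 'I_s -> H) :
  nonpos_index (fun x => '[gram_op f x - gram_op g x, x]) s.
Proof.
move=> v; have [c c0 cf] := lincomb_orthogonal hdot_hermitian v f (ltnSn s).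
by exists c => //; rewrite hdotBl gram_op_orthogonal// hdot0l sub0r oppr_le0 gram_op_ge0.
Qed.

Lemma nonpos_index_gram_rank s (f g : 'I_s -> H) (A : H -> H) :
  (forall x, A x = gram_op f x - gram_op g x) ->
  nonpos_index (fun x => '[A x, A x]) (s + s).
Proof.
move=> AE v.
have [c c0 cfg] := lincomb_orthogonal hdot_hermitian v
  (fun j : 'I_(s + s) => match fintype.split j with inl i => f i | inr i => g i end)
  (ltnSn (s + s)).
exists c => //; rewrite AE !gram_op_orthogonal ?subr0 ?hdot0l// => j.
  by have := cfg (unsplit (inr j)); rewrite unsplitK.
by have := cfg (unsplit (inl j)); rewrite unsplitK.
Qed.

(** Apply the index condition to preimages of [m + 1] independent vectors of the range: ['[A x, A x]
    <= 0] forces [A x = 0], a linear relation between those vectors. *)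
Lemma nonpos_index_finite_rank (A : H -> H) m : linear A ->
  nonpos_index (fun x => '[A x, A x]) m -> finite_rank A.
Proof.
move=> lA iA; apply: (@le_lt_trans _ _ m%:R%:E); last exact: ltry.
apply: ub_ereal_sup => _ [n [v [lv vA]] <-]; rewrite lee_fin ler_nat leqNgt.
apply/negP => mn; have /choice[x xv] : forall i, exists x, A x = v i.
  by move=> i; have [x _ <-] := vA i; exists x.
have [c c0] := iA (x \o widen_ord mn).
rewrite /= le_eqVlt (le_gtF (hdot_ge0 _)) orbF hdot_eq0 linear_lincomb// => /eqP cA.
have : lin_indep (v \o widen_ord mn).
  by apply: lin_indep_comp => // i j /(congr1 val)/= /val_inj.
move=> /lin_indepP lv'; move/eqP: c0; apply; apply: lv'; rewrite -cA.
by congr lincomb; apply/funext => i /=; rewrite xv.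
Qed.

(** On the span of the [e i] with [0 < a * l i] the form is diagonal with positive coefficients, so
    [s + 1] such indices are impossible. Taking [a] to be [1] or [-1] treats both signs. *)
Lemma nonpos_index_count (A : H -> H) n (e : 'I_n -> H) l a s :
  spectral_decomposition A e l -> nonpos_index (fun x => a * '[A x, x]) s ->
  (#|[pred i | (0 < a * l i)%R]| <= s)%N.
Proof.
move=> Ael iA; rewrite leqNgt; apply/negP => sn.
pose k i := enum_val (widen_ord sn i).
have kinj : injective k.
  by move=> i j /enum_val_inj /(congr1 val)/= /val_inj.
have ok := orthonormal_comp Ael kinj.
have [c c0] := iA (fun i => e (k i)).
rewrite linear_lincomb ?hdot_suml ?mulr_sumr; last exact: spectral_linear Ael.
have tE i : a * '[c 0 i *: A (e (k i)), lincomb (fun i => e (k i)) c] =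
    (a * l (k i)) * `|c 0 i| ^+ 2.
  rewrite (spectral_eigenvector Ael) !hdotZl hdotC.
  rewrite (herm_lincomb_delta hdot_hermitian)// normCK.
  by rewrite -mulrA; congr (_ * _); rewrite mulrCA.
have kp i : 0 < a * l (k i).
  by have := enum_valP (widen_ord sn i); rewrite inE.
under eq_bigr do rewrite tE.
move=> sle; have /eqP : \sum_i (a * l (k i)) * `|c 0 i| ^+ 2 = 0.
  apply/eqP; rewrite eq_le sle/= sumr_ge0// => i _.
  by rewrite mulr_ge0 ?exprn_ge0// ltW.
rewrite psumr_eq0 => [/allP ci|i _]; last by rewrite mulr_ge0 ?exprn_ge0// ltW.
move/eqP: c0; apply; apply/rowP => i; rewrite mxE.
have := ci i (mem_index_enum _); rewrite mulf_eq0 gt_eqF//= sqrf_eq0 normr_eq0.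
by move=> /eqP.
Qed.

(** The condition with [m] yields finite rank and so a spectral decomposition; the two conditions
    with [s] then bound the eigenvalue counts. *)
Lemma nonpos_index_causal_set s m (A : bop H) : self_adjoint A ->
  nonpos_index (fun x => '[A x, x]) s -> nonpos_index (fun x => - '[A x, x]) s ->
  nonpos_index (fun x => '[A x, A x]) m -> causal_set H s A.
Proof.
move=> sA pA nA rA; have /bounded_opP[lA _] := bop_funP A.
have fA := nonpos_index_finite_rank lA rA.
have [n [e [l Ael]]] := spectral_theorem lA sA fA.
split=> //.
- rewrite /num_pos_eigenvalues.
  rewrite (esum_dimension_eigenspace Ael (P := fun a => 0 < a)) ?ltxx//.
  rewrite lee_fin ler_nat;
  rewrite (@eq_card _ _ [pred i | 0 < 1 * l i]) => [|i]; last by rewrite !inE mul1r.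
  apply: (nonpos_index_count (a := 1) Ael) => v.
  by have [c c0 cv] := pA v; exists c; rewrite ?mul1r.
- rewrite /num_neg_eigenvalues.
  rewrite (esum_dimension_eigenspace Ael (P := fun a => a < 0)) ?ltxx//.
  rewrite lee_fin ler_nat.
  rewrite (@eq_card _ _ [pred i | 0 < -1 * l i]) => [|i]; last first.
    by rewrite !inE mulN1r oppr_gt0.
  apply: (nonpos_index_count (a := -1) Ael) => v.
  by have [c c0 cv] := nA v; exists c; rewrite ?mulN1r.
Qed.

End Characterization.

(** * Closedness under limits in the operator norm *)

Section Closedness.
Context {R : realType} {H : hilbertType R}.
Local Notation C := R[i].

Lemma norm_lincomb_le n (v : 'I_n -> H) (c : 'rV[C]_n) :
  `|lincomb v c| ^+ 2 <= (\sum_i `|v i|) ^+ 2 * \sum_i `|c 0 i| ^+ 2.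
Proof.
set S := \sum_i `|c 0 i| ^+ 2.
have S0 : 0 <= S by rewrite sumr_ge0// => i _; rewrite exprn_ge0.
have cS i : `|c 0 i| <= sqrtC S.
  rewrite -[leLHS]sqrCK// ler_sqrtC ?nnegrE ?exprn_ge0// /S (bigD1 i)//= lerDl.
  by rewrite sumr_ge0// => j _; rewrite exprn_ge0.
have -> : S = sqrtC S ^+ 2 by rewrite sqrtCK.
have V0 : 0 <= \sum_i `|v i| by rewrite sumr_ge0.
rewrite -exprMn lerXn2r ?nnegrE ?mulr_ge0 ?sqrtC_ge0//.
rewrite (le_trans (ler_norm_sum _ _ _))// mulr_suml ler_sum// => i _.
by rewrite normrZ mulrC ler_wpM2l.
Qed.

(* If [b] is positive definite on an (m+1)-dimensional space, a [b]-orthonormal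
   basis of that space yields a lower bound for [b] which survives small
   perturbations. *)
Lemma nonpos_index_closed (b : H -> H -> C) m : hermitian_form b ->
  (forall eps : R, 0 < eps -> exists2 q, nonpos_index q m &
    forall x, b x x <= q x + eps%:C%C * `|x| ^+ 2) ->
  nonpos_index (fun x => b x x) m.
Proof.
move=> hb bq v; apply: contrapT => nv.
have [|w ow] := exists_orthonormal_family hb (v := v).
  move=> c c0; rewrite real_ltNge ?real0 ?(herm_real hb)//; apply/negP => bc.
  by apply: nv; exists c.
pose K := \sum_i rnorm (w i).
have KE : \sum_i `|w i| = K%:C%C.
  by rewrite /K rmorph_sum; apply: eq_bigr => i _; rewrite /= -rnormE.
have K1 : 0 < K ^+ 2 + 1 by rewrite ltr_wpDl// sqr_ge0.
(* With this choice [eps * K ^+ 2 < 1], which contradicts the inequality [S <= eps * (K ^+ 2 * S)]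
   obtained below for [S > 0]. *)
have [|q iq bqe] := bq (K ^+ 2 + 1)^-1; first by rewrite invr_gt0.
have [c c0 qc] := iq w; set S := \sum_i `|c 0 i| ^+ 2.
have S0 : 0 < S.
  have [i ci] : exists i, c 0 i != 0 by apply/rV0Pn.
  rewrite /S (bigD1 i)//= ltr_pwDl ?exprn_gt0 ?normr_gt0//.
  by rewrite sumr_ge0// => j _; rewrite exprn_ge0.
have := bqe (lincomb w c); rewrite herm_lincomb// -/S => SqS.
have : S <= ((K ^+ 2 + 1)^-1)%:C%C * (K%:C%C ^+ 2 * S).
  rewrite (le_trans SqS)// -[leRHS]add0r lerD// -KE ler_wpM2l ?norm_lincomb_le//.
  by rewrite ler0c invr_ge0 ltW.
rewrite mulrA -rmorphXn -rmorphM/= -subr_ge0 -{2}[S]mul1r -mulrBl.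
rewrite pmulr_lge0// subr_ge0 -(rmorph1 (real_complex R)) lecR.
by rewrite ler_pdivlMl// mulr1 -subr_ge0 opprD addNKr oppr_ge0 ler10.
Qed.

Lemma hdot_bound (A : H -> H) (eps : R) x y :
  (forall x, rnorm (A x) <= eps * rnorm x) ->
  `|'[A x, y]| <= eps%:C%C * (`|x| * `|y|).
Proof.
move=> Ae; rewrite (le_trans (hdot_CauchySchwarz _ _))// mulrA ler_wpM2r//.
by rewrite !rnormE -rmorphM lecR.
Qed.

(** Self-adjointness passes to the limit, and the three forms attached to [B] are approximated by
    those of nearby [A], so [nonpos_index_closed] applies to each. *)
Lemma causal_set_closed s (B : bop H) :
  (forall eps : R, 0 < eps ->
    exists2 A : bop H, causal_set H s A & opnorm (B - A : bop H) <= eps) ->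
  causal_set H s B.
Proof.
move=> BA; have /bounded_opP[lB _] := bop_funP B.
have approx eps : 0 < eps -> exists2 A : bop H, causal_set H s A &
    forall x, rnorm (B x - A x) <= eps * rnorm x.
  move=> e0; have [A FA Ae] := BA eps e0; exists A => // x.
  have := opnormP x (bop_funP (B - A : bop H)) => /le_trans; apply.
  by rewrite ler_wpM2r ?rnorm_ge0.
have sB : self_adjoint B.
  move=> x y; apply/eqP; rewrite -subr_eq0 -normr_eq0 eq_le normr_ge0 andbT.
  pose k := rnorm x * rnorm y.
  have xyE : `|x| * `|y| = k%:C%C by rewrite !rnormE -rmorphM.
  have yxE : `|y| * `|x| = k%:C%C by rewrite mulrC.
  have k0 : 0 <= k by rewrite mulr_ge0 ?rnorm_ge0.
  rewrite -[leLHS]RRe_real ?normr_real// -(rmorph0 (real_complex R)) lecR.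
  apply/ler_addgt0Pr => eps e0; rewrite add0r -lecR RRe_real ?normr_real//.
  (* Two Cauchy-Schwarz errors occur, each proportional to [k]; the [+ 1] covers [k = 0]. *)
  have k1 : 0 < 2 * k + 1 by rewrite ltr_wpDl// mulr_ge0.
  have [|A [sA _ _ _] Ae] := approx (eps / (2 * k + 1)); first by rewrite divr_gt0.
  have -> : '[B x, y] - '[x, B y] = '[B x - A x, y] - '[x, B y - A y].
    by rewrite hdotBl hdotBr sA opprB [RHS]addrA subrK.
  rewrite (le_trans (ler_normB _ _))//.
  rewrite [X in _ + `|X|]hdotC norm_conjC.
  rewrite (le_trans (lerD (hdot_bound x y Ae) (hdot_bound y x Ae)))//.
  rewrite xyE yxE -mulrDr -rmorphD -rmorphM lecR -mulr2n -[k *+ 2]mulr_natl.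
  rewrite mulrAC ler_pdivrMr//; apply: ler_wpM2l; first exact: ltW.
  by rewrite lerDl.
have hB : hermitian_form (fun x y => '[B x, y]).
  split=> [z a x y|x y]; first by rewrite lB hdotDl hdotZl.
  by rewrite sB hdotC.
have diff A eps x : causal_set H s A ->
    (forall x, rnorm (B x - A x) <= eps * rnorm x) ->
    `|'[B x, x] - '[A x, x]| <= eps%:C%C * `|x| ^+ 2 /\
    '[B x, x] - '[A x, x] \is Num.real.
  move=> [sA _ _ _] Ae; rewrite -hdotBl; split.
    exact: (@hdot_bound (fun x => B x - A x)).
  by rewrite CrealE -hdotC hdotBl hdotBr sB sA.
apply: (@nonpos_index_causal_set _ _ s (s + s)) => //.
- apply: (nonpos_index_closed (b := fun x y => '[B x, y])) => // eps e0.
  have [A FA Ae] := approx eps e0; exists (fun x => '[A x, x]) => [|x].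
    have [f [g AE]] := causal_set_gram FA; move=> v.
    by have [c c0 cv] := nonpos_index_gram f g v; exists c; rewrite ?AE.
  have [dA rA] := diff A eps x FA Ae.
  by rewrite -lerBlDl (le_trans (real_ler_norm rA)).
- apply: (nonpos_index_closed (b := fun x y => - '[B x, y])) => [|eps e0].
    split=> [z a x y|x y]; first by rewrite lB hdotDl hdotZl opprD mulrN.
    by rewrite rmorphN/= sB -hdotC.
  have [A FA Ae] := approx eps e0; exists (fun x => - '[A x, x]) => [|x].
    have [f [g AE]] := causal_set_gram FA; move=> v.
    have [c c0 cv] := nonpos_index_gram g f v; exists c => //.
    by rewrite AE -hdotNl opprB.
  have [dA rA] := diff A eps x FA Ae; rewrite -lerBlDl opprK addrC.
  by rewrite (le_trans _ dA)// -normrN opprB real_ler_norm// -opprB rpredN.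
- apply: (nonpos_index_closed (b := fun x y => '[B x, B y])) => [|eps e0].
    split=> [z a x y|x y]; first by rewrite lB hdotDl hdotZl.
    exact: hdotC.
  (* This gives [2 * eta ^+ 2 <= eps], for use in [|B x|^2 <= 2 |A x|^2 + 2 |(B - A) x|^2]. The
     factor [2] in front of ['[A x, A x]] preserves the index condition. *)
  pose eta := Num.min 1 (eps / 2).
  have eta0 : 0 < eta by rewrite lt_min ltr01 divr_gt0.
  have [A FA Ae] := approx eta eta0.
  exists (fun x => 2 * '[A x, A x]) => [|x].
    have [f [g AE]] := causal_set_gram FA; move=> v.
    have [c c0 cv] := nonpos_index_gram_rank AE v; exists c => //.
    by rewrite pmulr_rle0.
  rewrite !hdotxx rnormE -(rmorph_nat (real_complex R)) -rmorphXn -!rmorphM.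
  rewrite -rmorphD lecR.
  have BxA : rnorm (B x) <= rnorm (A x) + eta * rnorm x.
    by rewrite -{1}[B x](subrK (A x)) addrC (le_trans (rnormD _ _))// lerD2l.
  apply: (@le_trans _ _ ((rnorm (A x) + eta * rnorm x) ^+ 2)).
    by rewrite lerXn2r ?nnegrE ?addr_ge0 ?mulr_ge0 ?rnorm_ge0 ?(ltW eta0).
  apply: (@le_trans _ _ (2 * rnorm (A x) ^+ 2 + 2 * (eta * rnorm x) ^+ 2)).
    rewrite -subr_ge0; set a := rnorm (A x); set d := _ * rnorm x.
    suff -> : 2 * a ^+ 2 + 2 * d ^+ 2 - (a + d) ^+ 2 = (a - d) ^+ 2 by rewrite sqr_ge0.
    by ring.
  rewrite lerD2l exprMn mulrA ler_wpM2r ?sqr_ge0// mulrC -ler_pdivlMr//.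
  by rewrite expr2 (le_trans (ler_piMr _ _))// ?(ltW eta0)// ge_min lexx ?orbT.
Qed.

End Closedness.

(** * Completeness *)

Lemma rnormN (R : realType) (V : normedModType R[i]) (x : V) : rnorm (- x) = rnorm x.
Proof. by rewrite /rnorm normrN. Qed.

Section Completeness.
Context {R : realType} {H : hilbertType R} {s : nat}.
Local Notation F := (causal_ops H s).

Lemma ball_causalE (A B : F) (e : R) :
  ball A e B = (opnorm (val A - val B : bop H) < e) :> Prop.
Proof. by []. Qed.

Lemma ball_normR (V : normedModType R[i]) (x y : V) (e : R) :
  ball x e%:C%C y = (rnorm (x - y) < e) :> Prop.
Proof. by rewrite -ball_normE/= rnormE ltcR. Qed.

Lemma cauchy_opnorm (G : set_system F) (e : R) : ProperFilter G -> cauchy G ->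
  0 < e -> exists2 Q, G Q &
    forall A B : F, Q A -> Q B -> opnorm (val A - val B : bop H) < e.
Proof.
move=> FG cG e0.
have [|[Q1 Q2] /= [GQ1 GQ2] Qe] := cG [set AB : F * F | ball AB.1 e AB.2].
  by rewrite -entourage_ballE; exists e.
exists (Q1 `&` Q2); first exact: filterI.
by move=> A B [QA _] [_ QB]; exact: (Qe (A, B)).
Qed.

Lemma complex_gt0 (e : R[i]) : 0 < e ->
  exists2 r : R, 0 < r & e = r%:C%C.
Proof.
move=> e0; exists (complex.Re e); first by move: e0; rewrite ltcE => /andP[].
by rewrite RRe_real// gtr0_real.
Qed.

(** The limit is taken pointwise in the complete space [H]; the Cauchy estimate, uniform in [x],
    makes it bounded and a limit in norm, and [causal_set_closed] puts it in [F]. *)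
Lemma causal_ops_complete : complete_space F.
Proof.
move=> G FG cG.
have opx (A B : F) x e : opnorm (val A - val B : bop H) < e ->
    rnorm (val A x - val B x) <= e * rnorm x.
  move=> ABe; have := opnormP x (bop_funP (val A - val B : bop H)).
  by move=> /le_trans; apply; rewrite ler_wpM2r ?rnorm_ge0// ltW.
have cvgx x : cvg ((fun A : F => val A x) @ G).
  apply: cauchy_cvg; apply: cauchy_exP => _ /complex_gt0[e e0 ->].
  have x1 : 0 < rnorm x + 1 by rewrite ltr_wpDl ?rnorm_ge0.
  have [|Q GQ Qe] := @cauchy_opnorm G (e / (rnorm x + 1)) FG cG.
    by rewrite divr_gt0.
  have [A QA] := filter_ex GQ; exists (val A x).
  apply: (@filterS _ G _ Q _ _ GQ) => B QB; rewrite /= ball_normR.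
  rewrite (le_lt_trans (opx _ _ _ _ (Qe _ _ QA QB)))// mulrAC ltr_pdivrMr//.
  by rewrite ltr_pM2l// ltrDl.
pose B x := lim ((fun A : F => val A x) @ G).
have BP x : (fun A : F => val A x) @ G --> B x by exact: cvgx.
have lB : linear B.
  move=> a x y; rewrite {1}/B; apply: (cvg_lim (@norm_hausdorff _ H)).
  rewrite (_ : (fun A : F => _) =
    (a \*: (fun A : F => val A x)) + (fun A : F => val A y)).
    by exact: (cvgD (cvgZl_tmp (BP x)) (BP y)).
  by apply/funext => A; have /bounded_opP[lA _] := bop_funP (val A); exact: lA.
(* One of the two operators in the Cauchy estimate is sent to the limit, at the cost of an arbitrary
   slack [d]. *)
have QB e Q (A : F) x : G Q -> (forall A B : F, Q A -> Q B ->
    opnorm (val A - val B : bop H) < e) -> Q A ->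
    rnorm (val A x - B x) <= e * rnorm x.
  move=> GQ Qe QA; apply/ler_addgt0Pr => d d0.
  have : G (Q `&` [set A : F | ball (B x) d%:C%C (val A x)]).
    apply: filterI => //; have /cvg_ballP := BP x; apply.
    by rewrite ltcR.
  move=> /filter_ex[A' [QA']]; rewrite /= ball_normR => BA'.
  rewrite -(subrKA (val A' x)) (le_trans (rnormD _ _))// lerD//; last first.
    by rewrite -opprB rnormN ltW.
  by rewrite opx// Qe.
have bB : B \in bounded_op.
  apply/bounded_opP; split=> //.
  have [Q GQ Qe] := cauchy_opnorm FG cG (@ltr01 R).
  have [A QA] := filter_ex GQ; exists (opnorm (val A) + 1) => x.
  rewrite -[B x](subKr (val A x)) mulrDl (le_trans (rnormD _ _))// lerD//.
    by rewrite opnormP// bop_funP.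
  by rewrite rnormN; exact: QB GQ Qe QA.
pose B' : bop H := BOp bB.
have near e : 0 < e -> G [set A : F | opnorm (val A - B' : bop H) <= e].
  move=> e0; have [Q GQ Qe] := cauchy_opnorm FG cG e0.
  apply: (@filterS _ G _ Q _ _ GQ) => A QA /=; apply: opnorm_le; first exact: ltW.
  by move=> x; exact: QB GQ Qe QA.
have opnC (A A' : bop H) : opnorm (A - A' : bop H) = opnorm (A' - A : bop H).
  by apply: (@complexI R); rewrite -!bop_normE distrC.
have FB : causal_set H s B'.
  apply: causal_set_closed => e e0; have [A AB] := filter_ex (near e e0).
  by exists (val A); [exact: set_valP|rewrite opnC].
exists (SigSub (mem_set FB) : F).
apply/cvg_ballP => e e0.
(* [near] gives a weak inequality while a ball needs a strict one. *)
have e2 : 0 < e / 2 by rewrite divr_gt0.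
apply: (@filterS _ G _ _ _ _ (near _ e2)) => A /= AB; rewrite /nbhs/= ball_causalE opnC/=.
by rewrite (le_lt_trans AB)// ltr_pdivrMr// ltr_pMr// ltr1n.
Qed.

End Completeness.

(** * Separability *)

Section Separability.
Context {R : realType} {H : hilbertType R} {s : nat}.
Local Notation F := (causal_ops H s).
Implicit Types f g : 'I_s -> H.

Lemma rnorm_hdotZ (x f g : H) : rnorm ('[x, f] *: g) <= rnorm f * rnorm g * rnorm x.
Proof.
rewrite rnormZ mulrAC ler_wpM2r ?rnorm_ge0// -lecR RRe_real ?normr_real//.
by rewrite (le_trans (hdot_CauchySchwarz _ _))// !rnormE -rmorphM mulrC.
Qed.

Lemma rnorm_sum n (v : 'I_n -> H) : rnorm (\sum_i v i) <= \sum_i rnorm (v i).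
Proof.
apply: (big_ind2 (fun x (a : R) => rnorm x <= a)) => //; first by rewrite rnorm0.
by move=> x1 a1 x2 a2 x1a x2a; rewrite (le_trans (rnormD _ _))// lerD.
Qed.

Lemma gram_op_bounded f : gram_op f \in bounded_op.
Proof.
apply/bounded_opP; split.
  move=> a x y; rewrite /gram_op scaler_sumr -big_split/=; apply: eq_bigr => j _.
  by rewrite hdotDl hdotZl scalerDl scalerA.
exists (\sum_j rnorm (f j) * rnorm (f j)) => x; rewrite (le_trans (rnorm_sum _))//.
by rewrite mulr_suml ler_sum// => j _; exact: rnorm_hdotZ.
Qed.

Lemma opnormN (A : bop H) : opnorm (- A : bop H) = opnorm A.
Proof. by apply: (@complexI R); rewrite -!bop_normE normrN. Qed.

Definition gram_bop f : bop H := BOp (gram_op_bounded f).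

Lemma gram_op_self_adjoint f : self_adjoint (gram_op f).
Proof.
move=> x y; rewrite hdot_suml hdot_sumr; apply: eq_bigr => j _.
by rewrite hdotZl hdotZr -hdotC mulrC.
Qed.

Lemma gram_bop_causal f g : causal_set H s (gram_bop f - gram_bop g).
Proof.
apply: (@nonpos_index_causal_set _ _ s (s + s)).
- by move=> x y; rewrite /= hdotBl hdotBr !gram_op_self_adjoint.
- exact: nonpos_index_gram.
- move=> v; have [c c0 cv] := nonpos_index_gram g f v; exists c => //.
  by rewrite -hdotNl opprB.
- exact: nonpos_index_gram_rank.
Qed.

Definition gram_causal f g : F := SigSub (mem_set (gram_bop_causal f g)).

Lemma gram_causal_surj (A : F) : exists f g, A = gram_causal f g.
Proof.
have [f [g AE]] := causal_set_gram (set_valP A).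
by exists f, g; apply/val_inj/val_inj/funext.
Qed.

Lemma gram_op_continuous f (e : R) : 0 < e ->
  exists2 d : R, 0 < d & forall g, (forall j, rnorm (f j - g j) < d) ->
    opnorm (gram_bop f - gram_bop g : bop H) <= e.
Proof.
move=> e0; pose M := \sum_j (2 * rnorm (f j) + 1).
have M0 : 0 <= M by rewrite sumr_ge0// => j _; rewrite addr_ge0 ?mulr_ge0 ?rnorm_ge0.
have M1 : 0 < M + 1 by rewrite ltr_wpDl.
(* The [1] ensures [rnorm (g j) <= rnorm (f j) + 1], so the [j]-th summand changes by at most
   [e / (M + 1) * (2 * rnorm (f j) + 1)] times [rnorm x]. The divisor [M + 1] is positive even for
   [s = 0]. *)
exists (Num.min 1 (e / (M + 1))) => [|g fg].
  by rewrite lt_min ltr01 divr_gt0.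
apply: opnorm_le => [|x]; first exact: ltW.
rewrite [X in rnorm X](_ : _ = \sum_j ('[x, f j] *: f j - '[x, g j] *: g j)); last first.
  by rewrite sumrB.
apply: (@le_trans _ _ (e / (M + 1) * M * rnorm x)); last first.
  rewrite ler_wpM2r ?rnorm_ge0// mulrAC ler_pdivrMr// ler_wpM2l ?ltW//.
  by rewrite ltrDl.
rewrite (le_trans (rnorm_sum _))// mulr_sumr mulr_suml ler_sum// => j _.
have := fg j; rewrite lt_min => /andP[fg1 /ltW fge].
have -> : '[x, f j] *: f j - '[x, g j] *: g j =
    '[x, f j] *: (f j - g j) + '[x, f j - g j] *: g j.
  by rewrite scalerBr hdotBr scalerBl subrKA.
have gf : rnorm (g j) <= rnorm (f j) + 1.
  rewrite -[g j](subKr (f j)) (le_trans (rnormD _ _))// rnormN lerD2l.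
  exact: ltW.
rewrite (le_trans (rnormD _ _))//.
rewrite (le_trans (lerD (rnorm_hdotZ _ _ _) (rnorm_hdotZ _ _ _)))//.
rewrite -mulrDl ler_wpM2r ?rnorm_ge0// [rnorm (f j) * _]mulrC -mulrDr.
rewrite ler_pM ?rnorm_ge0 ?addr_ge0 ?rnorm_ge0//.
by rewrite mulr_natl mulr2n -addrA lerD2l.
Qed.

(** An injection of [D] into [nat] is inverted; indices it does not attain are sent to [t], an extra
    point harmless to density. *)
Lemma dense_enumeration (T : topologicalType) (t : T) : separable_space T ->
  exists u : nat -> T, dense (range u).
Proof.
move=> [D /countable_injP[h hinj] dD].
exists (fun n => xget t [set x | D x /\ h x = n]) => O O0 oO.
have [x [Ox Dx]] := dD O O0 oO; exists x; split=> //; exists (h x) => //.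
apply: xget_unique => // y [Dy hxy]; apply: hinj => //; exact: mem_set.
Qed.

Lemma causal_ops_separable : separable_space H -> separable_space F.
Proof.
move=> /(dense_enumeration 0)[u du].
(* Finite functions into [nat] form a countable type, so the range of [S] is countable. *)
pose S (k : {ffun 'I_s -> nat} * {ffun 'I_s -> nat}) : F :=
  gram_causal (u \o k.1) (u \o k.2).
have approx f (d : R) : 0 < d ->
    exists k : {ffun 'I_s -> nat}, forall j, rnorm (f j - u (k j)) < d.
  move=> d0; have /choice[k kd] : forall j, exists n, rnorm (f j - u n) < d.
    move=> j; have [||x [/interior_subset fx [n _ nx]]] := du (ball (f j) d%:C%C)^°.
    - by exists (f j); apply: nbhsx_ballx; rewrite ltcR.
    - exact: open_interior.
    - by exists n; move: fx; rewrite ball_normR nx.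
  by exists (finfun k) => j; rewrite ffunE.
exists (range S).
  exact: card_le_trans (card_image_le _ _) (countableP _).
move=> O [A OA] oO; have [f [g AE]] := gram_causal_surj A.
have /nbhs_ballP[e /= e0 eO] : nbhs A O by exact: open_nbhs_nbhs.
(* Two errors of at most [e / 4] stay strictly below [e]. *)
have e4 : 0 < e / 4 by rewrite divr_gt0.
have [d1 d10 fd1] := gram_op_continuous f e4.
have [d2 d20 gd2] := gram_op_continuous g e4.
have [k1 /fd1 fk1] := approx f _ d10.
have [k2 /gd2 gk2] := approx g _ d20.
exists (S (k1, k2)); split; last by exists (k1, k2).
apply: eO; rewrite ball_causalE AE.
set Ff := gram_bop f; set Fg := gram_bop g.
set Gf := gram_bop (u \o k1); set Gg := gram_bop (u \o k2).
change (is_true (opnorm (Ff - Fg - (Gf - Gg) : bop H) < e)).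
have -> : Ff - Fg - (Gf - Gg) = (Ff - Gf) - (Fg - Gg) :> bop H.
  by rewrite !opprB [Gg - Gf]addrC addrACA [- Fg + Gg]addrC.
rewrite (le_lt_trans (opnormD _ _))// opnormN.
rewrite (le_lt_trans (lerD (fk1 : opnorm (Ff - Gf) <= _)
  (gk2 : opnorm (Fg - Gg) <= _)))//.
by rewrite -mulrDr gtr_pMr//; lra.
Qed.

End Separability.

Theorem theoremA1 (R : realType) (H : hilbertType R) (s : nat)
    (sepH : separable_space H) :
  polish R (causal_ops H s) /\ @separable_complete_metric R (causal_ops H s).
Proof.
have FP : @separable_complete_metric R (causal_ops H s).
  by split; [exact: causal_ops_separable | exact: causal_ops_complete].
(* The metric induces the topology already carried by [F], so the identity is the homeomorphism. *)
split=> //; exists (causal_ops H s) => //; exists id, id; first by [].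
by split=> x; exact: cvg_id.
Qed.
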